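(* Let $m$ be a positive integer, let $\ell=3\cdot 2^m-4$, and let $P_\ell$ denote the path of length $\ell$ (i.e., on $\ell+1$ vertices). Then $P_\ell\in\mathrm{TM}_{2m+1}^m$, but for every integer $d$ we have $P_{\ell+1}\notin\mathrm{TM}_d^m$.
   Context: All graphs are finite, simple and undirected. A tree-model of $m$ colours and depth $d$ of a graph $G$ is a rooted tree $T$ with a set $S\subseteq\{1,\dots,m\}^2\times\{1,\dots,d\}$ such that: every root-to-leaf path of $T$ has length exactly $d$; the leaves of $T$ are exactly $V(G)$; each leaf gets one of the colours $1,\dots,m$; $(i,j,\ell)\in S$ iff $(j,i,\ell)\in S$; and for distinct $u,v\in V(G)$ coloured $i,j$ at distance $2\ell$ in $T$, $uv\in E(G)$ iff $(i,j,\ell)\in S$. $\mathrm{TM}_d^m$ is the class of graphs having such a tree-model. *)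

(* Defs.v *)
From HB Require Import structures.
From mathcomp Require Import all_boot.

Set Implicit Arguments.
Unset Strict Implicit.
Unset Printing Implicit Defensive.

Record sgraph := SGraph {
  vert :> finType;
  adj : rel vert;
  adj_sym : symmetric adj;
  adj_irr : irreflexive adj }.

(* [p] lists the vertices of the walk after its start [x], so [size p] is the
   length of the walk. *)
Definition walk (G : sgraph) (x y : G) (p : seq G) : bool :=
  path (@adj G) x p && (last x p == y).

Definition at_dist (G : sgraph) (x y : G) (n : nat) : Prop :=
  (exists2 p, walk x y p & size p = n) /\ (forall p, walk x y p -> n <= size p).

Definition connected (G : sgraph) : Prop := forall x y : G, exists p, walk x y p.

(* [ucycle] also accepts a single edge traversed back and forth, as a cycle of
   size 2; a cycle of a simple graph has at least 3 vertices. *)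
Definition acyclic (G : sgraph) : Prop :=
  forall c : seq G, ucycle (@adj G) c -> size c < 3.

Record rtree := RTree {
  rtree_graph :> sgraph;
  rtree_root : rtree_graph;
  rtree_connected : connected rtree_graph;
  rtree_acyclic : acyclic rtree_graph }.

Definition child (T : rtree) (x y : T) : Prop :=
  adj x y /\ exists k, at_dist (rtree_root T) x k /\ at_dist (rtree_root T) y k.+1.

(* With this definition the root of a one-node tree is a leaf. *)
Definition leaf (T : rtree) (x : T) : Prop := forall y : T, ~ child x y.

(* The colours 1, ..., m are represented by 'I_m.  The identification of the
   leaves of the tree with the vertices of G is the injection [tm_leaf]. *)
Record tree_model (m d : nat) (G : sgraph) := TreeModel {
  tm_tree : rtree;
  tm_leaf : G -> tm_tree;
  tm_colour : G -> 'I_m;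
  tm_S : 'I_m -> 'I_m -> nat -> bool;
  tm_S_level : forall i j l, tm_S i j l -> 1 <= l <= d;
  tm_S_sym : forall i j l, tm_S i j l = tm_S j i l;
  tm_depth : forall (x : tm_tree) (p : seq tm_tree),
    leaf x -> walk (rtree_root tm_tree) x p -> uniq (rtree_root tm_tree :: p) -> size p = d;
  tm_leaf_inj : injective tm_leaf;
  tm_leafP : forall x : tm_tree, leaf x <-> exists u : G, tm_leaf u = x;
  tm_adj : forall (u v : G) (l : nat),
    u != v -> at_dist (tm_leaf u) (tm_leaf v) (2 * l) ->
    adj u v = tm_S (tm_colour u) (tm_colour v) l }.

Definition TM (d m : nat) (G : sgraph) : Prop := inhabited (tree_model m d G).

Definition path_adj (n : nat) : rel 'I_n.+1 :=
  [rel i j : 'I_n.+1 | (i.+1 == j :> nat) || (j.+1 == i :> nat)].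

Lemma path_adj_sym n : symmetric (@path_adj n).
Proof. by move=> i j; rewrite /path_adj /= orbC. Qed.

Lemma path_adj_irr n : irreflexive (@path_adj n).
Proof. by move=> i; rewrite /path_adj /= orbb eqn_leq ltnn. Qed.

(* The path of length n, on n.+1 vertices. *)
Definition path_graph (n : nat) : sgraph :=
  SGraph (@path_adj_sym n) (@path_adj_irr n).

(* Main.v *)
Require Import Defs.
From mathcomp Require Import all_boot zify.

(** Write f(m) = 3 * 2^m - 3, so that f(m+1) = 2 f(m) + 3.

    Upper bound.  Cut a coloured path with m+1 colours along the highest level
    that separates two consecutive vertices k, k+1, of colours i and j.  All
    pairs of colours i, j in different classes are adjacent, and a path
    tolerates few such pairs: either one of the two colours lives in a window of
    three consecutive vertices, which leaves two subpaths with m colours, or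
    both live in two windows of four vertices, which leaves three subpaths with
    m-1 colours, and 3 f(m-1) + 8 <= 2 f(m) + 3.

    Lower bound.  The path on f(m+1) vertices is a block of three vertices of a
    new colour between two copies of the path on f(m) vertices.  The middle of
    the block is separated at the top level, and the two other vertices of the
    block are siblings of the end vertices to which they are attached. *)

Set Implicit Arguments.
Unset Strict Implicit.
Unset Printing Implicit Defensive.

(** * Trees given by a parent function *)

Lemma at_dist_inj (G : sgraph) (x y : G) k n :
  at_dist x y k -> at_dist x y n -> k = n.
Proof.
move=> [[p wp <-] minp] [[q wq <-] minq].
by apply/eqP; rewrite eqn_leq minp // minq.
Qed.

Lemma walk_cat (G : sgraph) (x y z : G) p q :
  walk x y p -> walk y z q -> walk x z (p ++ q).
Proof.
rewrite /walk cat_path last_cat => /andP[-> /eqP->] /andP[-> ->].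
by [].
Qed.

Lemma walk_rev (G : sgraph) (x y : G) p :
  walk x y p -> exists2 q, walk y x q & size q = size p.
Proof.
move=> /andP[xp /eqP <-]; exists (rev (belast x p)); last first.
  by rewrite size_rev size_belast.
rewrite /walk rev_path (eq_path (e' := @adj G)) ?xp /=; last first.
  by move=> a b; rewrite adj_sym.
case: p xp => //= a p _; rewrite rev_cons last_rcons //.
Qed.

(** Shared by both directions: every [rtree] carries such a structure, and the constructed tree is
    defined by one. The root is its own parent, so that iterates of [par] are total and stop
    there. *)
Record parent_structure (G : sgraph) (r : G) (par : G -> G) (dep : G -> nat) :
    Prop := ParentStructure {
  par_root : par r = r;
  dep_root : dep r = 0;
  dep_par : forall x, x != r -> dep x = (dep (par x)).+1;
  adj_par : forall x y,
    adj x y = (x != r) && (par x == y) || (y != r) && (par y == x) }.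

Section ParentStructure.
Variables (G : sgraph) (r : G) (par : G -> G) (dep : G -> nat).
Hypothesis PS : parent_structure r par dep.

Lemma dep_eq0 x : (dep x == 0) = (x == r).
Proof.
have [->|/(dep_par PS)->//] := eqVneq x r.
by rewrite (dep_root PS).
Qed.

Lemma dep_par_pred x : dep (par x) = (dep x).-1.
Proof.
have [->|/(dep_par PS)->//] := eqVneq x r.
by rewrite (par_root PS) (dep_root PS).
Qed.

Lemma dep_iter k x : dep (iter k par x) = dep x - k.
Proof.
by elim: k => [|k IH]; rewrite ?subn0 // iterS dep_par_pred IH subnS.
Qed.

Lemma iter_par_root k : iter k par r = r.
Proof. by elim: k => //= k ->; apply: par_root PS. Qed.

Lemma iter_par_dep k x : dep x <= k -> iter k par x = r.
Proof. by rewrite -subn_eq0 -dep_iter dep_eq0 => /eqP. Qed.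

Lemma iter_par_eq_leq x y k n :
  k <= n -> iter k par x = iter k par y -> iter n par x = iter n par y.
Proof. by move=> /subnK<- E; rewrite !iterD E. Qed.

Lemma walk_up k x : k <= dep x ->
  exists2 p, walk x (iter k par x) p & size p = k.
Proof.
elim: k => [|k IH] kx; first by exists [::]; rewrite // /walk /= eqxx.
have [p wp sp] := IH (ltnW kx).
exists (rcons p (iter k.+1 par x)); last by rewrite size_rcons sp.
rewrite -cats1; apply: walk_cat wp _.
by rewrite /walk /= (adj_par PS) !eqxx /= andbT -dep_eq0 dep_iter; lia.
Qed.

(** Induction from the front: a first step up lengthens the climb from [x]; a first step down
    cancels a step of that climb or, if there is none, lengthens the climb from [y]. *)
Lemma walk_meet x y p : walk x y p ->
  exists a b, iter a par x = iter b par y /\ a + b <= size p.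
Proof.
elim: p x => [|z p IH] x; first by move=> /eqP /= ->; exists 0, 0.
move=> /andP[/= /andP[xz zp] /eqP lp].
have /IH[a [b [E ab]]] : walk z y p by rewrite /walk zp lp /=.
move: xz; rewrite (adj_par PS) => /orP[] /andP[_ /eqP Ez].
  by exists a.+1, b; rewrite iterSr Ez; split.
case: a => [|a] in E ab *.
  by exists 0, b.+1; rewrite /= -E Ez addnS.
by exists a, b; rewrite -Ez -iterSr; split=> //; lia.
Qed.

Lemma at_dist_root x : at_dist r x (dep x).
Proof.
split.
  have [p wp sp] := walk_up (leqnn (dep x)).
  move: wp; rewrite iter_par_dep // => /walk_rev[q wq sq].
  by exists q; rewrite // sq.
move=> p /walk_meet[a [b [E ab]]].
move: E; rewrite iter_par_root => /(congr1 dep).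
by rewrite dep_iter (dep_root PS); lia.
Qed.

(** Turns tree distance into the height at which iterated parents first agree, the only form in
    which distances are used later. *)
Lemma at_dist_meet x y l : dep x = dep y ->
  at_dist x y (2 * l) <->
  iter l par x = iter l par y /\
  (forall k, k < l -> iter k par x <> iter k par y).
Proof.
move=> xy.
have walk_dd k : k <= dep x -> iter k par x = iter k par y ->
    exists2 p, walk x y p & size p = 2 * k.
  move=> kx E; have [p wp sp] := walk_up kx.
  have ky : k <= dep y by rewrite -xy.
  have [q /walk_rev[s ws <-] sq] := walk_up ky.
  by rewrite -E in ws; exists (p ++ s);
    [apply: walk_cat wp ws | rewrite size_cat; lia].
(* Depths are truncated at 0, so unequal climbs can meet only once both have reached the root. *)
have dd a b : iter a par x = iter b par y ->
    a = b \/ dep x <= a /\ dep x <= b.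
  by move=> /(congr1 dep); rewrite !dep_iter; lia.
have [Er1 Er2] : iter (dep x) par x = r /\ iter (dep x) par y = r.
  by split; apply: iter_par_dep; rewrite ?xy.
split=> [[[p wp sp] minp]|[El minl]].
  split.
    have [a [b [E ab]]] := walk_meet wp; have [ab1|[xa xb]] := dd _ _ E.
      by rewrite -ab1 in E; apply: iter_par_eq_leq E; lia.
    by apply: (@iter_par_eq_leq _ _ (dep x)); [lia | rewrite Er1 Er2].
  move=> k kl E.
  have [kx|kx] := leqP k (dep x).
    by have [q /minp] := walk_dd _ kx E; lia.
  by have [|q /minp] := walk_dd _ (leqnn (dep x)); [rewrite Er1 Er2 | lia].
have lx : l <= dep x.
  by rewrite leqNgt; apply/negP => /minl; rewrite Er1 Er2.
split; first exact: walk_dd.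
move=> p /walk_meet[a [b [E ab]]].
have [ab1|[xa xb]] := dd _ _ E; last by lia.
rewrite -ab1 in E ab; have [la|/minl//] := leqP l a; lia.
Qed.

Lemma parent_connected : connected G.
Proof.
move=> x y; have [[p wp _] _] := at_dist_root x.
have [[q wq _] _] := at_dist_root y.
by have [s ws _] := walk_rev wp; exists (s ++ q); apply: walk_cat ws wq.
Qed.

(* Both neighbours on a cycle of a vertex of maximal depth are its parent. *)
Lemma parent_acyclic : acyclic G.
Proof.
move=> c /andP[cc uc]; rewrite ltnNge; apply/negP => sc.
have [x xc maxx] : exists2 x, x \in c & forall y, y \in c -> dep y <= dep x.
  case: c sc {cc uc} => // x0 c _.
  exists [arg max_(x > x0 in x0 :: c) dep x];
    by case: arg_maxnP; rewrite ?mem_head.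
have {}maxx y : y \in c -> adj x y -> y = par x.
  move=> /maxx; rewrite (adj_par PS) => dy /orP[] /andP[ny /eqP E] //.
  by move: dy; rewrite (dep_par PS ny) E ltnn.
have [i p Ep] := rot_to xc.
have inp y : y \in p -> y \in c.
  by move=> yp; rewrite -(mem_rot i) Ep inE yp orbT.
move: cc uc sc; rewrite -(rot_cycle i) -(rot_uniq i) -(size_rot i) Ep.
case/lastP: p inp {Ep} => [|p z] inp //=.
case: p inp => [|y p] inp //=; rewrite !rcons_path last_rcons.
move=> /and3P[/maxx xy _ zx] /and3P[_ + _] _; rewrite xy; last first.
  by apply: inp; rewrite mem_head.
rewrite adj_sym in zx; rewrite -(maxx z) ?mem_rcons ?mem_head //.
by apply: inp; rewrite mem_rcons mem_head.
Qed.

(* A path leaving the root can never turn back, so it only goes down. *)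
Lemma size_path_from_root x p :
  walk r x p -> uniq (r :: p) -> size p = dep x.
Proof.
suff down z : path (@adj G) z p -> uniq (z :: p) ->
    z = r \/ par z \notin p -> dep (last z p) = dep z + size p.
  move=> /andP[rp /eqP<-] /(down _ rp) ->; last by left.
  by rewrite (dep_root PS).
elim: p z => [|y p IH] z /=; first by rewrite addn0.
rewrite (adj_par PS) inE => /andP[/orP[]/andP[nz /eqP E] yp].
  by move=> _ []; [move/eqP: nz | rewrite E mem_head].
move=> /andP[/norP[_ zp] up] _; rewrite IH //; last by right; rewrite E.
by rewrite (dep_par PS nz) E addSnnS.
Qed.

End ParentStructure.

(** * Root paths in a rooted tree *)

(* Two paths that leave x by different edges a and b close up to a cycle at the
   first vertex of the one which lies on the other. *)
Lemma acyclic_uniq_walk (G : sgraph) (x y : G) p q : acyclic G ->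
  walk x y p -> uniq (x :: p) -> walk x y q -> uniq (x :: q) -> p = q.
Proof.
move=> acG; elim: p x q => [|a p IH] x [|b q] //.
- by move=> /eqP /= <- _ /andP[_ /eqP /= <-] /andP[+ _]; rewrite mem_last.
- by move=> /andP[_ /eqP /= lp] /andP[+ _] /eqP /= E; rewrite E -lp mem_last.
move=> /andP[ap /eqP lp] /andP[xNp up] /andP[bq /eqP lq] /andP[xNq uq].
have [ab|/eqP ab] := eqVneq a b.
  subst b; move: ap bq lp lq => /= /andP[_ ap] /andP[_ bq] lp lq.
  by rewrite (IH a q) // /walk ?ap ?bq ?lp ?lq eqxx.
exfalso; change (is_true (uniq (a :: p))) in up.
change (is_true (uniq (b :: q))) in uq.
have hasq : has (mem (b :: q)) (a :: p).
  by apply/hasP; exists y; [rewrite -lp /= | rewrite /= -lq /=];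
    apply: mem_last.
have hd : head x (a :: p) <> head x (b :: q) by [].
have [z [p1 [p2 [Ep zq p1q]]]] : exists z p1 p2,
    [/\ a :: p = rcons p1 z ++ p2, z \in b :: q & ~~ has (mem (b :: q)) p1].
  by case: (split_find hasq) => z p1 p2 zq p1q; exists z, p1, p2.
rewrite {}Ep in ap up xNp hd.
move: bq uq xNq hd p1q {lq}.
have {zq} [q1 [q2 ->]] : exists q1 q2, b :: q = q1 ++ z :: q2.
  by case/splitPr: zq => q1 q2; exists q1, q2.
rewrite cat_path /= => /and3P[xq1 q1z _].
move: ap; rewrite cat_path rcons_path => /andP[/andP[xp1 p1z] _].
rewrite cat_uniq /= negb_or => /and4P[uq1 /andP[zq1 _] _ _].
rewrite mem_cat inE !negb_or => /and3P[xNq1 xz _].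
move: up; rewrite cat_uniq rcons_uniq => /and3P[/andP[zp1 up1] _ _].
move: xNp; rewrite mem_cat mem_rcons inE !negb_or => /andP[/andP[_ xNp1] _].
move=> hd p1q.
have /acG : ucycle (@adj G) (x :: p1 ++ z :: rev q1).
  apply/andP; split.
    rewrite /= rcons_cat cat_path xp1 /= p1z /=.
    have := rev_path (@adj G) x (rcons q1 z).
    rewrite last_rcons belast_rcons rev_cons => ->.
    rewrite (eq_path (e' := @adj G)) ?rcons_path ?xq1 //.
    by move=> u v; rewrite adj_sym.
  rewrite /= mem_cat inE mem_rev !negb_or xNp1 xz xNq1 cat_uniq /= up1.
  rewrite mem_rev zq1 rev_uniq uq1 /= !andbT negb_or zp1 /=.
  apply: contra p1q => /hasP[u]; rewrite mem_rev => uq up.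
  by apply/hasP; exists u => //=; rewrite mem_cat uq.
(* The walks start differently, so [p1] and [q1] are not both empty and the cycle has at least three
   vertices. *)
rewrite /= size_cat /= size_rev.
by case: p1 q1 hd {xp1 p1z zp1 up1 xNp1 p1q xq1 q1z uq1 zq1 xNq1} =>
  [|u p1] [|v q1] //= hd; lia.
Qed.

Section RootedTree.
Variable T : rtree.
Let r := rtree_root T.

Definition root_path (x : T) : seq T :=
  shorten r (xchoose (rtree_connected r x)).

Lemma root_pathP x : walk r x (root_path x) /\ uniq (r :: root_path x).
Proof.
rewrite /root_path; have := xchooseP (rtree_connected r x).
move: (xchoose _) => p /andP[rp /eqP <-].
by case: (shortenP rp) => q rq uq _; rewrite /walk rq eqxx.
Qed.

Lemma root_path_unique x p :
  walk r x p -> uniq (r :: p) -> p = root_path x.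
Proof.
move=> wp up; have [wx ux] := root_pathP x.
exact: acyclic_uniq_walk (@rtree_acyclic T) wp up wx ux.
Qed.

Lemma root_path_root : root_path r = [::].
Proof. by symmetry; apply: root_path_unique; rewrite // /walk /=. Qed.

(** If [y] is off the root path of [x], appending it gives a path. Otherwise the prefix up to [y] is
    the root path of [y] and avoids [x], so the roles are exchanged. *)
Lemma root_path_adj x y : adj x y ->
  root_path y = rcons (root_path x) y \/ root_path x = rcons (root_path y) x.
Proof.
suff IN u v : adj u v -> v \notin r :: root_path u ->
    root_path v = rcons (root_path u) v.
  move=> xy; have [yx|/IN yx] := boolP (y \in r :: root_path x); last first.
    by left; apply: yx.
  right; apply: IN; first by rewrite adj_sym.
  have [] := root_pathP x; set p := root_path x in yx * => /andP[rp /eqP lp] up.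
  have [p1 [p2 [Ep ly]]] : exists p1 p2, p = p1 ++ p2 /\ last r p1 = y.
    by case/splitPl: yx => p1 p2 ly; exists p1, p2.
  have -> : root_path y = p1.
    symmetry; apply: root_path_unique.
      by move: rp; rewrite Ep cat_path /walk ly eqxx => /andP[->].
    by move: up; rewrite Ep -cat_cons cat_uniq => /andP[].
  apply/negP => xp1; case: p2 => [|z p2] in Ep.
    by move: xy; rewrite -ly -lp Ep cats0 adj_irr.
  move: up; rewrite Ep -cat_cons cat_uniq => /and3P[_ /hasPn/(_ x)].
  by rewrite -{1}lp Ep last_cat /= mem_last => /(_ isT)/negP.
move=> uv vN; have [wu uu] := root_pathP u; symmetry; apply: root_path_unique.
  by rewrite -cats1; apply: walk_cat wu _; rewrite /walk /= uv eqxx.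
by rewrite -rcons_cons rcons_uniq vN.
Qed.

(** Root paths omit the root, so the default [r] of [last] is the right parent for children of the
    root, and it makes the root its own parent. *)
Definition tree_parent (x : T) : T :=
  last r (take (size (root_path x)).-1 (root_path x)).

Lemma root_path_rcons x : x != r ->
  root_path x = rcons (root_path (tree_parent x)) x.
Proof.
move=> xr; have [] := root_pathP x; rewrite /tree_parent.
case/lastP: (root_path x) => [|p y].
  by move=> /eqP /= Er; rewrite Er eqxx in xr.
rewrite /walk rcons_path last_rcons => /andP[/andP[rp _] /eqP->] up.
rewrite size_rcons /= -[in take _ _]cats1 take_size_cat //.
rewrite -(@root_path_unique _ p) //; first by rewrite /walk rp eqxx.
by move: up; rewrite -rcons_cons rcons_uniq => /andP[].
Qed.

Lemma rtree_parent_structure :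
  parent_structure r tree_parent (fun x => size (root_path x)).
Proof.
have rr x y : root_path x = rcons (root_path y) x -> x != r.
  by apply: contra_eq_neq => ->; rewrite root_path_root; case: (root_path y).
have inj x y : root_path x = root_path y -> x = y.
  have [[/andP[_ /eqP lx] _] [/andP[_ /eqP ly] _]] :=
    (root_pathP x, root_pathP y).
  by move=> E; rewrite -lx -ly E.
split=> [||x xr|x y].
- by rewrite /tree_parent root_path_root.
- by rewrite root_path_root.
- by rewrite {1}root_path_rcons // size_rcons.
apply/idP/orP => [/root_path_adj[] E|].
- right; have yr := rr _ _ E; rewrite yr; apply/eqP/inj.
  by move: E; rewrite root_path_rcons // => /rcons_inj[].
- left; have xr := rr _ _ E; rewrite xr; apply/eqP/inj.
  by move: E; rewrite root_path_rcons // => /rcons_inj[].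
have adjp z : z != r -> adj z (tree_parent z).
  move=> zr; have [] := root_pathP z; rewrite (root_path_rcons zr).
  have [/andP[_ /eqP lz] _] := root_pathP (tree_parent z).
  by rewrite /walk rcons_path lz adj_sym => /andP[/andP[_ ->]].
by case=> /andP[zr /eqP<-]; rewrite 1?[adj (tree_parent _) _]adj_sym adjp.
Qed.

End RootedTree.

(** * Long paths have no tree-model *)

Definition consecutive (x y : nat) : bool := (x.+1 == y) || (y.+1 == x).

(** As [k] and [k.+1] are adjacent and separated by [f], their two colours are adjacent across any
    two classes. So a position of one colour shares the class of a position of the other or is next
    to it; this is played against the two classes [f k] and [f k.+1]. *)
Lemma crossing_colours (C : eqType) (K : eqType) (a b k : nat)
    (c : nat -> C) (f : nat -> K) (s : rel C) :
  symmetric s -> a <= k -> k.+1 < b -> f k <> f k.+1 ->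
  (forall x y, a <= x < b -> a <= y < b -> f x <> f y ->
    consecutive x y = s (c x) (c y)) ->
  (exists i p, [/\ exists2 x, a <= x < b & c x = i &
    forall x, a <= x < b -> c x = i -> p <= x < p + 3]) \/
  (exists i j p q, [/\ i != j, exists2 x, a <= x < b & c x = i,
    exists2 x, a <= x < b & c x = j &
    forall x, a <= x < b -> c x = i \/ c x = j ->
      (p <= x < p + 4) || (q <= x < q + 4)]).
Proof.
move=> ss ak kb fk E.
have kI : a <= k < b by lia.
have k1I : a <= k.+1 < b by lia.
have skk : s (c k) (c k.+1) by rewrite -E // /consecutive eqxx.
have [i Ei] : exists i, i = c k by exists (c k).
have [j Ej] : exists j, j = c k.+1 by exists (c k.+1).
have {E}cross x y : a <= x < b -> a <= y < b -> c x = i -> c y = j ->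
    f x = f y \/ x = y.+1 \/ y = x.+1.
  move=> xI yI cx cy; case: (f x =P f y) => [|fxy]; [by left | right].
  have: consecutive x y by rewrite E // cx cy Ei Ej.
  by rewrite /consecutive; lia.
have [ij|ij] := eqVneq i j.
  rewrite -ij in Ej cross; left; exists i.
  have near x : a <= x < b -> c x = i -> k <= x.+1 <= k.+3.
    move=> xI cx.
    have [fx|?] := cross x k xI kI cx (esym Ei); last by lia.
    have [fx'|?] := cross x k.+1 xI k1I cx (esym Ej); last by lia.
    by case: fk; rewrite -fx.
  (* [near] leaves four positions, but [k.-1] and [k.+2] cannot both have colour [i]: not being next
     to each other, nor to [k.+1] and [k] respectively, they would put [k] and [k.+1] in one
     class. *)
  have [/andP[ltak /eqP ck]|noprev] := boolP ((a < k) && (c k.-1 == i)).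
    exists k.-1; split; first by exists k.
    move=> x xI cx; have := near x xI cx.
    have [Ex|] := eqVneq x k.+2; last by lia.
    have pI : a <= k.-1 < b by lia.
    have [f1|?] := cross k.-1 x pI xI ck cx; last by lia.
    have [f2|?] := cross k.-1 k.+1 pI k1I ck (esym Ej); last by lia.
    have [f3|?] := cross x k xI kI cx (esym Ei); last by lia.
    by case: fk; rewrite -f2 f1 f3.
  exists k; split; first by exists k.
  move=> x xI cx; have := near x xI cx.
  have [Ex|] := eqVneq x k.-1; last by lia.
  rewrite -Ex cx eqxx andbT in noprev; lia.
(* If colour [i] misses the class of [k.+1], it occurs only next to [k.+1]; in the next case split,
   if colour [j] misses the class of [k], it occurs only next to [k]. Either way a window of three
   suffices. *)
have [/existsP[x /andP[/andP[xI /eqP cx] /eqP fx]]|iW] :=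
    boolP [exists x : 'I_b, (a <= x) && (c x == i) && (f x == f k.+1)];
  last first.
  left; exists i, k; split; first by exists k.
  move=> x xI cx; have [fx|] := cross x k.+1 xI k1I cx (esym Ej); last by lia.
  have xb : x < b by lia.
  by case/existsP: iW; exists (Ordinal xb); rewrite /= cx fx !eqxx; lia.
have [/existsP[y /andP[/andP[yI /eqP cy] /eqP fy]]|jW] :=
    boolP [exists y : 'I_b, (a <= y) && (c y == j) && (f y == f k)];
  last first.
  left; exists j, k.-1; split; first by exists k.+1.
  move=> y yI cy; have [fy|] := cross k y kI yI (esym Ei) cy; last by lia.
  have yb : y < b by lia.
  by case/existsP: jW; exists (Ordinal yb); rewrite /= cy -fy !eqxx; lia.
(* Now [x] and [y] are separated like [k.+1] and [k], hence consecutive. Each position of colour [i]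
   or [j] misses one of the two classes, so it is next to one of [k], [k.+1], [x], [y]: each window
   is a consecutive pair with a margin of one on both sides. *)
right; exists i, j, k.-1.
have {}xI : a <= x < b by rewrite xI /=.
have {}yI : a <= y < b by rewrite yI /=.
have xy : x = y.+1 :> nat \/ y = x.+1 :> nat.
  by have [fxy|//] := cross x y xI yI cx cy; case: fk; rewrite -fx -fy.
have nI z : a <= z < b -> c z = i ->
    z = k.-1 \/ z = k \/ z = k.+2 \/ z = y.-1 \/ z = y.+1.
  move=> zI cz; have [fz|] := cross z k.+1 zI k1I cz (esym Ej); last by lia.
  have [fz'|] := cross z y zI yI cz cy; last by lia.
  by case: fk; rewrite -fz fz' fy.
have nJ z : a <= z < b -> c z = j ->
    z = k.-1 \/ z = k.+1 \/ z = x.-1 \/ z = x.+1.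
  move=> zI cz; have [fz|] := cross k z kI zI (esym Ei) cz; last by lia.
  have [fz'|] := cross x z xI zI cx cz; last by lia.
  by case: fk; rewrite fz -fz' fx.
exists (minn x y).-1; split=> //; [by exists k | by exists k.+1|].
by move=> z zI [/nI|/nJ] /(_ zI); lia.
Qed.

(** [f l x] stands for the ancestor of position [x] at height [l]. With an interval and a colour set
    [D] as parameters, the subpaths between windows inherit all hypotheses, and strong induction on
    [#|D|] applies. *)
Lemma path_length_bound (C : finType) (K : eqType) (c : nat -> C)
    (f : nat -> nat -> K) (s : C -> C -> nat -> bool) (D : {set C})
    (a b d : nat) :
  (forall i j l, s i j l = s j i l) ->
  (forall x y, a <= x < b -> a <= y < b -> f 0 x = f 0 y -> x = y) ->
  (forall x y, a <= x < b -> a <= y < b -> f d x = f d y) ->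
  (forall l x y, a <= x < b -> a <= y < b -> f l x <> f l y ->
    f l.+1 x = f l.+1 y -> consecutive x y = s (c x) (c y) l.+1) ->
  (forall x, a <= x < b -> c x \in D) ->
  b - a <= 3 * 2 ^ #|D| - 3.
Proof.
move=> ss f0.
have [n] := ubnP #|D|; elim: n => // n IH in D a b f0 * => Dn fd E cD.
have IHs (D' : {set C}) a' b' : D' \proper D -> a <= a' -> b' <= b ->
    (forall x, a' <= x < b' -> c x \in D') -> b' - a' <= 3 * 2 ^ #|D'| - 3.
  move=> /proper_card D'D aa' bb' cD'.
  apply: IH => //; first by move=> x y xI yI; apply: f0; lia.
  - by lia.
  - by move=> x y xI yI; apply: fd; lia.
  - by move=> l x y xI yI; apply: E; lia.
have [ab|ab] := leqP b a.+1.
  have [ab'|ab'] := leqP b a; first by lia.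
  have : 0 < #|D| by apply/card_gt0P; exists (c a); apply: cD; lia.
  case: #|D| => // q _; have := expn_gt0 2 q; rewrite expnS; lia.
(* [L.+1] is the least height at which all positions agree; it is positive because [f 0] separates
   the positions. At height [L] some consecutive pair differs, as otherwise all positions would
   agree already. *)
have [L Ld [k [ak kb fk]]] : exists2 L,
    (forall x y, a <= x < b -> a <= y < b -> f L.+1 x = f L.+1 y) &
    exists k, [/\ a <= k, k.+1 < b & f L k <> f L k.+1].
  pose all_eq l := [forall x : 'I_b, forall y : 'I_b,
    (a <= x) ==> (a <= y) ==> (f l x == f l y)].
  have all_eqP l : reflect
      (forall x y, a <= x < b -> a <= y < b -> f l x = f l y) (all_eq l).
    apply: (iffP 'forall_forallP) => H x y.
      move=> /andP[ax xb] /andP[ay yb].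
      by have := H (Ordinal xb) (Ordinal yb); rewrite /= ax ay => /eqP.
    by apply/implyP => ax; apply/implyP => ay; apply/eqP/H; rewrite ?ax ?ay /=.
  have exl : exists l, all_eq l by exists d; apply/all_eqP.
  case: (ex_minnP exl) => -[/all_eqP H0 _|L HL minL].
    suff: a = a.+1 by lia.
    by apply: f0; [lia | lia | apply: H0; lia].
  exists L; first exact/all_eqP.
  have [/existsP[k /andP[/andP[ak kb] /eqP fk]]|H] := boolP [exists k : 'I_b,
      (a <= k) && (k.+1 < b) && (f L k != f L k.+1)]; first by exists k.
  suff /minL : all_eq L by rewrite ltnn.
  have H1 n' : a + n' < b -> f L (a + n') = f L a.
    elim: n' => [|n' IHn] nb; first by rewrite addn0.
    rewrite -IHn; last by lia.
    have nb' : a + n' < b by lia.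
    apply/eqP; apply: contraNT H => H; apply/existsP; exists (Ordinal nb').
    by rewrite /= -addnS eq_sym H nb leq_addr.
  have H2 x : a <= x < b -> f L x = f L a.
    by move=> /andP[ax xb]; have := H1 (x - a); rewrite subnKC //; apply.
  by apply/all_eqP => x y /H2 -> /H2 ->.
have ssL : symmetric (fun i j => s i j L.+1) by move=> i j; apply: ss.
have := @crossing_colours C K a b k c (f L) _ ssL ak kb fk.
case=> [x y xI yI fxy|[i [p [[x0 x0I cx0] iw]]]|
    [i [j [p [q [ij [x0 x0I cx0] [y0 y0I cy0] w]]]]]].
- by apply: E => //; apply: Ld.
- have iD : i \in D by rewrite -cx0 cD.
  have sub := properD1 iD; have := cardsD1 i D; rewrite iD => ->.
  have := IHs _ a (minn p b) sub; have := IHs _ (maxn a (p + 3)) b sub.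
  have cDi x : a <= x < b -> ~~ (p <= x < p + 3) -> c x \in D :\ i.
    move=> xI xp; rewrite !inE cD // andbT; apply: contra xp => /eqP.
    exact: iw.
  move=> H1 H2.
  have {}H1 : b - maxn a (p + 3) <= 3 * 2 ^ #|D :\ i| - 3.
    by apply: H1 => [||x xI]; [lia|lia|apply: cDi; lia].
  have {}H2 : minn p b - a <= 3 * 2 ^ #|D :\ i| - 3.
    by apply: H2 => [||x xI]; [lia|lia|apply: cDi; lia].
  by have := expn_gt0 2 #|D :\ i|; rewrite add1n expnS; lia.
wlog pq : p q w / p <= q.
  move=> H; have [/H|/ltnW/H] := leqP p q; first exact.
  by apply=> x xI /(w x xI); rewrite orbC.
have iD : i \in D by rewrite -cx0 cD.
have jD : j \in D by rewrite -cy0 cD.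
have jDi : j \in D :\ i by rewrite !inE eq_sym ij.
have sub : D :\ i :\ j \proper D.
  exact: proper_trans (properD1 jDi) (properD1 iD).
have := cardsD1 i D; have := cardsD1 j (D :\ i); rewrite iD jDi => -> ->.
set D' := D :\ i :\ j in sub *.
have cDij x : a <= x < b -> ~~ (p <= x < p + 4) -> ~~ (q <= x < q + 4) ->
    c x \in D'.
  move=> xI xp xq; rewrite !inE cD // andbT.
  have := w x xI; rewrite (negbTE xp) (negbTE xq) /= => {}w.
  by apply/andP; split; apply/eqP => cx; suff: false by []; apply: w; tauto.
have H1 : minn p b - a <= 3 * 2 ^ #|D'| - 3.
  by apply: IHs => // [|x xI]; [lia|apply: cDij; lia].
have H2 : minn q b - maxn a (p + 4) <= 3 * 2 ^ #|D'| - 3.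
  by apply: IHs => // [||x xI]; [lia|lia|apply: cDij; lia].
have H3 : b - maxn a (q + 4) <= 3 * 2 ^ #|D'| - 3.
  by apply: IHs => // [|x xI]; [lia|apply: cDij; lia].
by have := expn_gt0 2 #|D'|; rewrite !add1n !expnS; lia.
Qed.

(** All leaves have depth [d], so [at_dist_meet] reads adjacency off the first common ancestor, and
    the iterated parents of the leaves satisfy the hypotheses of [path_length_bound]. *)
Lemma path_notin_TM m d n : 3 * 2 ^ m - 3 <= n -> ~ TM d m (path_graph n).
Proof.
move=> mn [[T lf c S Slev Ssym Hd linj leafP Hadj]].
have PS := rtree_parent_structure T.
set r := rtree_root T in PS Hd; set par := @tree_parent T in PS.
pose f l x := iter l par (lf (inord x : 'I_n.+1)).
have dlf u : size (root_path (lf u)) = d.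
  have [wu uu] := root_pathP (lf u).
  by apply: Hd wu uu; apply/leafP; exists u.
have := @path_length_bound 'I_m T (fun x => c (inord x)) f
  (fun i j l => S i j l) setT 0 n.+1 d.
rewrite cardsT card_ord => H; suff: n.+1 - 0 <= 3 * 2 ^ m - 3 by lia.
apply: H => //.
- move=> x y xI yI /linj /(congr1 val) /=; rewrite !inordK //.
- by move=> x y _ _; rewrite /f !(iter_par_dep PS) ?dlf.
move=> l x y xI yI fl flS.
rewrite -Hadj; last first.
- apply/(at_dist_meet PS); first by rewrite !dlf.
  split=> // k kl E; apply: fl; exact: iter_par_eq_leq E.
- by apply/eqP => xy; apply: fl; rewrite /f xy.
by rewrite /= /path_adj /= !inordK.
Qed.

(** * Tree-models from nested equivalences *)

Section KeyTree.
Variables (G : finType) (K : eqType) (d : nat) (u0 : G) (key : nat -> G -> K).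
Hypothesis keyS : forall t u v, key t u = key t v -> key t.+1 u = key t.+1 v.
Hypothesis keyd : forall u v, key d u = key d v.

(** Classes are named by vertices because [K] may be infinite, while the nodes of a tree form a
    [finType]. *)
Definition key_rep (t : nat) (u : G) : G :=
  odflt u [pick v | key t v == key t u].

Lemma key_key_rep t u : key t (key_rep t u) = key t u.
Proof. by rewrite /key_rep; case: pickP => //= v /eqP. Qed.

Lemma key_rep_eq t u v : (key_rep t u == key_rep t v) = (key t u == key t v).
Proof.
apply/eqP/eqP => [E|E]; first by rewrite -key_key_rep E key_key_rep.
rewrite /key_rep; have -> : [pick w | key t w == key t v] =
  [pick w | key t w == key t u] by apply: eq_pick => w /=; rewrite E.
by case: pickP => //= /(_ u); rewrite eqxx.
Qed.

Lemma key_rep_id t u : key_rep t (key_rep t u) = key_rep t u.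
Proof. by apply/eqP; rewrite key_rep_eq key_key_rep. Qed.

(* A node at height t (the leaves have height 0) is a class of key t, given by
   its canonical representative. *)
Definition key_node : finType :=
  {x : 'I_d.+1 * G | key_rep x.1 x.2 == x.2}.

Lemma knode_subproof t u :
  let x : 'I_d.+1 * G := (inord (minn t d), key_rep (minn t d) u) in
  key_rep x.1 x.2 == x.2.
Proof. by rewrite /= inordK ?ltnS ?geq_minr // key_rep_id. Qed.

(** Capping heights at [d] makes [knode] total and the root its own parent. *)
Definition knode t u : key_node :=
  exist (fun x : 'I_d.+1 * G => key_rep x.1 x.2 == x.2) _ (knode_subproof t u).
Definition kheight (x : key_node) : nat := (val x).1.
Definition kparent (x : key_node) : key_node := knode (kheight x).+1 (val x).2.
Definition kroot : key_node := knode d u0.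

Lemma kheight_le x : kheight x <= d.
Proof. by rewrite -ltnS ltn_ord. Qed.

Lemma kheight_knode t u : kheight (knode t u) = minn t d.
Proof. by rewrite /kheight /= inordK // ltnS geq_minr. Qed.

Lemma knode_eq t u v : t <= d -> (knode t u == knode t v) = (key t u == key t v).
Proof.
move=> /minn_idPl td.
by rewrite -val_eqE /= xpair_eqE eqxx /= key_rep_eq td.
Qed.

Lemma knodeE x : x = knode (kheight x) (val x).2.
Proof.
apply/val_inj; have := valP x; have := kheight_le x; rewrite /kheight.
case: x => -[t u] /= H /minn_idPl -> /eqP ->.
by congr pair; apply/val_inj; rewrite /= inordK.
Qed.

Lemma knode_min t u : knode (minn t d) u = knode t u.
Proof. by apply/val_inj; rewrite /= -minnA minnn. Qed.

(** [kparent] is computed from the chosen representative; [keyS] makes the result independent of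
    this choice, and [keyd] settles the capped heights. *)
Lemma kparent_knode t u : kparent (knode t u) = knode t.+1 u.
Proof.
rewrite /kparent kheight_knode; have [td|td] := leqP t d; last first.
  rewrite -knode_min -[RHS]knode_min; have -> : minn d.+1 d = d by lia.
  have -> : minn t.+1 d = d by lia.
  by apply/eqP; rewrite knode_eq //; apply/eqP/keyd.
rewrite -[RHS]knode_min -[LHS]knode_min; apply/eqP.
rewrite knode_eq; last by lia.
rewrite /= (minn_idPl td); move: td; rewrite leq_eqVlt => /orP[/eqP->|td].
  by rewrite (minn_idPr (leqnSn d)); apply/eqP/keyd.
by rewrite (minn_idPl td); apply/eqP/keyS/key_key_rep.
Qed.

Lemma kroot_eq x : (x == kroot) = (kheight x == d).
Proof.
apply/eqP/eqP => [->|xd]; first by rewrite kheight_knode minnn.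
by rewrite (knodeE x) xd; apply/eqP; rewrite knode_eq //; apply/eqP/keyd.
Qed.

Lemma kheight_parent x : x != kroot -> kheight (kparent x) = (kheight x).+1.
Proof. by rewrite kroot_eq kheight_knode; have := kheight_le x; lia. Qed.

Definition kadj : rel key_node := fun x y =>
  (x != kroot) && (kparent x == y) || (y != kroot) && (kparent y == x).

Lemma kadj_sym : symmetric kadj.
Proof. by move=> x y; rewrite /kadj orbC. Qed.

Lemma kadj_irr : irreflexive kadj.
Proof.
move=> x; rewrite /kadj orbb; apply/negP => /andP[/kheight_parent + /eqP E].
by rewrite E; lia.
Qed.

Definition key_graph : sgraph := SGraph kadj_sym kadj_irr.

Lemma key_parent_structure :
  @parent_structure key_graph kroot kparent (fun x => d - kheight x).
Proof.
split=> //= [||x xr].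
- by rewrite /kroot kparent_knode; apply/eqP; rewrite -knode_min kroot_eq
    kheight_knode; lia.
- by rewrite kheight_knode minnn subnn.
by rewrite kheight_parent //; move: xr; rewrite kroot_eq;
  have := kheight_le x; lia.
Qed.

Definition key_tree : rtree :=
  @RTree key_graph kroot (parent_connected key_parent_structure)
    (parent_acyclic key_parent_structure).

Lemma iter_kparent k u : iter k kparent (knode 0 u) = knode k u.
Proof. by elim: k => //= k ->; rewrite kparent_knode. Qed.

Lemma key_leaf (x : key_tree) : leaf x <-> exists u, knode 0 u = x.
Proof.
have PS := key_parent_structure; split.
  move=> lx; exists (val x).2; rewrite [RHS](knodeE x).
  case E: (kheight x) => [//|t]; exfalso.
  have td : t < d by rewrite -E kheight_le.
  apply: (lx (knode t (val x).2)).
  have px : kparent (knode t (val x).2) = x by rewrite kparent_knode -E -knodeE.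
  have hn : kheight (knode t (val x).2) = t by rewrite kheight_knode; lia.
  split; first by rewrite /= /kadj px eqxx !kroot_eq hn andbT; lia.
  exists (d - kheight x); split; first exact: at_dist_root PS x.
  have -> : (d - kheight x).+1 = d - kheight (knode t (val x).2) by lia.
  exact: at_dist_root PS _.
move=> [u <-] y [_ [k [kx]]].
rewrite -(at_dist_inj (at_dist_root PS (knode 0 u)) kx) kheight_knode.
by move=> /(at_dist_inj (at_dist_root PS y)); lia.
Qed.

End KeyTree.

Lemma TM_of_keys (m d : nat) (G : sgraph) (K : eqType) (u0 : G)
    (key : nat -> G -> K) (c : G -> 'I_m) (s : 'I_m -> 'I_m -> nat -> bool) :
  injective (key 0) ->
  (forall t u v, key t u = key t v -> key t.+1 u = key t.+1 v) ->
  (forall u v, key d u = key d v) ->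
  (forall i j l, s i j l = s j i l) ->
  (forall u v l, l < d -> key l u <> key l v -> key l.+1 u = key l.+1 v ->
    adj u v = s (c u) (c v) l.+1) ->
  TM d m G.
Proof.
move=> key0 keyS keyd ss E.
pose T := key_tree u0 keyS keyd.
(* The restriction to levels from 1 to [d] is what [tm_S_level] demands. *)
pose s' i j l := (1 <= l <= d) && s i j l.
have PS := key_parent_structure u0 keyS keyd.
constructor; apply: (@TreeModel m d G T (@knode G K d key 0) c s').
- by move=> i j l /andP[].
- by move=> i j l; rewrite /s' ss.
- move=> x p /key_leaf[u <-] wp up.
  by rewrite (size_path_from_root PS wp up) kheight_knode; lia.
- by move=> u v /eqP; rewrite knode_eq // => /eqP /key0.
- exact: key_leaf.
move=> u v l uv /(at_dist_meet PS); rewrite !kheight_knode => /(_ erefl).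
rewrite !iter_kparent // => -[El minl].
case: l => [|l] in El minl *.
  by move/eqP: El; rewrite knode_eq // => /eqP /key0 /eqP; rewrite (negbTE uv).
have ld : l < d.
  rewrite ltnNge; apply/negP => dl; apply: (minl l (ltnSn l)).
  rewrite !iter_kparent // -knode_min -[RHS]knode_min (minn_idPr dl).
  by apply/eqP; rewrite knode_eq //; apply/eqP/keyd.
rewrite /s' ld /=; apply: E => //.
  move=> E; apply: (minl l (ltnSn l)); rewrite !iter_kparent //.
  by apply/eqP; rewrite knode_eq ?E //; lia.
by apply/eqP; rewrite -(knode_eq (d := d)) // El.
Qed.

(** * A tree-model of the extremal path *)

(* Positions are w = 2, ..., 3 * 2 ^ m - 2.  Block B consists of 3B-1, 3B, 3B+1
   and has colour v_2(B), the exponent of 2 in B.  Gap g is the pair 3g+1, 3g+2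
   of the end of block g and the start of block g+1.  The gaps are merged
   two by two at even heights, while the middle vertex 3B joins the gaps around
   it at height 2 v_2(B) + 3. *)
Definition block_colour (w : nat) : nat := logn 2 ((w + 1) %/ 3).

(** [inl] marks a vertex still alone, [inr] a group of merged gaps. A middle [3 * B] joins the group
    of gap [B]; at its joining height the gaps [B.-1] and [B] are already merged, so both neighbours
    are met at once. *)
Definition ruler_key (t w : nat) : nat + nat :=
  if (t == 0) || (3 %| w) && (t < 2 * block_colour w + 3) then inl w
  else inr (w %/ 3 %/ 2 ^ t./2).

(** The two vertices of a gap lie in blocks with consecutive numbers, exactly one of them odd, so
    exactly one has colour 0. The second disjunct joins a middle to the rest of its block. *)
Definition ruler_rel (i j t : nat) : bool :=
  (t == 1) && ((i == 0) != (j == 0)) || (i == j) && (t == 2 * i + 3).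

Lemma block_colour_mid B : block_colour (3 * B) = logn 2 B.
Proof. by rewrite /block_colour; congr logn; lia. Qed.

Lemma ruler_keyS t w w' :
  ruler_key t w = ruler_key t w' -> ruler_key t.+1 w = ruler_key t.+1 w'.
Proof.
rewrite /ruler_key.
case: ifP => Hw; case: ifP => Hw' // [E]; first by rewrite E.
have -> : (t.+1 == 0) || (3 %| w) && (t.+1 < 2 * block_colour w + 3) = false.
  by move: Hw; lia.
have -> : (t.+1 == 0) || (3 %| w') && (t.+1 < 2 * block_colour w' + 3) = false.
  by move: Hw'; lia.
congr inr; have [o|o] := boolP (odd t).
  have -> : t.+1./2 = t./2.+1 by lia.
  by rewrite expnSr !divnMA E.
by have -> : t.+1./2 = t./2 by lia.
Qed.

Lemma logn2_dvd i B : 0 < B -> (2 ^ i %| B) = (i <= logn 2 B).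
Proof. by move=> B0; rewrite pfactor_dvdn. Qed.

(** Applied to the gaps [B.-1] and [B] on the two sides of block [B], with [q] a power of 2. *)
Lemma divn_pred_eq q B : ~~ (q %| B) -> (B.-1) %/ q = B %/ q.
Proof.
case: B => [|B] //= qB; case: q => [|q] in qB *; first by rewrite !divn0.
by rewrite divnS // (negbTE qB).
Qed.

(* B and B' are odd multiples of the same power of 2. *)
Lemma logn2_divn_inj v B B' : 0 < B -> 0 < B' -> logn 2 B = v ->
  logn 2 B' = v -> B %/ 2 ^ v.+1 = B' %/ 2 ^ v.+1 -> B = B'.
Proof.
move=> B0 B0' lB lB'; rewrite expnSr !divnMA.
have F C : 0 < C -> logn 2 C = v ->
    odd (C %/ 2 ^ v) /\ C = C %/ 2 ^ v * 2 ^ v.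
  move=> C0 lC; have vC : 2 ^ v %| C by rewrite logn2_dvd // lC.
  have E : C = C %/ 2 ^ v * 2 ^ v by rewrite divnK.
  split=> //; have : ~~ (2 ^ v.+1 %| C) by rewrite logn2_dvd // lC ltnn.
  by rewrite {1}E expnS dvdn_pmul2r ?expn_gt0 // dvdn2 negbK.
have [o1 E1] := F _ B0 lB; have [o2 E2] := F _ B0' lB'.
move=> E; rewrite E1 E2; congr muln; move: o1 o2 E; lia.
Qed.

Lemma logn2_eq0 B : 0 < B -> (logn 2 B == 0) = odd B.
Proof.
by move=> B0; have := logn2_dvd 1 B0; rewrite expn1 dvdn2 lt0n => /negb_inj.
Qed.

Lemma ruler_rel_sym i j t : ruler_rel i j t = ruler_rel j i t.
Proof.
by rewrite /ruler_rel [(j == 0) == _]eq_sym [j == i]eq_sym;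
  case: (eqVneq i j) => // ->.
Qed.

(** Three kinds of meeting heights: at 1 the two vertices of a gap meet, at larger odd heights
    middles join, and at even heights groups of gaps merge. *)
Lemma ruler_key_adj l w w' : 1 < w -> 1 < w' ->
  ruler_key l w <> ruler_key l w' -> ruler_key l.+1 w = ruler_key l.+1 w' ->
  consecutive w w' = ruler_rel (block_colour w) (block_colour w') l.+1.
Proof.
move=> w1 w1' Nl El.
have ww' : w <> w' by move=> E; apply: Nl; rewrite E.
move: El; rewrite {1 2}/ruler_key; case: ifP => Hw; case: ifP => Hw' // [] // Eq.
case: l => [|l] in Nl Hw Hw' Eq *.
  move: Eq Hw Hw'; rewrite expn0 !divn1 => Eq Hw Hw'.
  wlog lt : w w' w1 w1' ww' Eq Hw Hw' {Nl} / w < w'.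
    move=> H; have [|] := ltnP w w'; first exact: H.
    move=> lew; rewrite ruler_rel_sym -H //; [|lia|lia].
    by rewrite /consecutive orbC.
  have [g0 Ew Ew'] : [/\ 0 < w %/ 3, w = 3 * (w %/ 3) + 1
    & w' = 3 * (w %/ 3) + 2] by split; lia.
  move: g0 Ew Ew'; move: (w %/ 3) => g g0 Ew Ew'.
  have -> : consecutive w w' by rewrite /consecutive; lia.
  have -> : block_colour w = logn 2 g by rewrite /block_colour; congr logn; lia.
  have -> : block_colour w' = logn 2 g.+1.
    by rewrite /block_colour; congr logn; lia.
  by rewrite /ruler_rel /= !logn2_eq0 //=; case: (odd g).
have {}Eq : w %/ 3 %/ 2 ^ l.+2./2 = w' %/ 3 %/ 2 ^ l.+2./2 := Eq.
have [ol|ol] := boolP (odd l).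
(* Odd meeting height: the exponent of 2 is the same as one level below, so one of the two vertices
   must be a middle that joins here. *)
- wlog act : w w' w1 w1' ww' Hw Hw' Eq Nl /
      (3 %| w) && (l.+1 < 2 * block_colour w + 3).
    move=> H; have [|act] := boolP ((3 %| w) && (l.+1 < 2 * block_colour w + 3)).
      exact: H.
    have [act'|act'] :=
        boolP ((3 %| w') && (l.+1 < 2 * block_colour w' + 3)).
      rewrite ruler_rel_sym -H //; first by rewrite /consecutive orbC.
        exact: nesym.
      exact: nesym.
    case: Nl; rewrite /ruler_key /= (negbTE act) (negbTE act').
    have -> : uphalf l = l.+2./2 by lia.
    by rewrite Eq.
  have [/dvdnP[B EB] lB] := andP act; rewrite mulnC in EB.
  have B0 : 0 < B by lia.
  have v : block_colour w = logn 2 B by rewrite EB block_colour_mid.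
  have lE : l.+2 = 2 * logn 2 B + 3.
    by move: Hw; rewrite EB dvdn_mulr //= -EB v; lia.
  have ihalf : l.+2./2 = (logn 2 B).+1 by lia.
  rewrite ihalf in Eq; have wB : w %/ 3 = B by lia.
  rewrite wB in Eq.
  rewrite /ruler_rel v lE eqxx andbT /=.
  have -> : (2 * logn 2 B + 3 == 1) = false by lia.
  rewrite /=; apply/idP/eqP => [cw|Ev].
    have : (w' + 1) %/ 3 = B by move: cw; rewrite /consecutive; lia.
    by rewrite /block_colour => ->.
  (* Whichever gap [B'] or [B'.-1] holds [w'], the quotient is that of [B']; equal colours and equal
     quotients then force the same block. *)
  pose B' := (w' + 1) %/ 3; have B0' : 0 < B' by rewrite /B'; lia.
  have lB' : logn 2 B' = logn 2 B by rewrite Ev.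
  suff BB' : B = B' by move: ww'; rewrite /consecutive; lia.
  apply: (logn2_divn_inj B0 B0' erefl lB'); rewrite Eq.
  have [->//|->] : w' %/ 3 = B' \/ w' %/ 3 = B'.-1 by rewrite /B'; lia.
  by apply: divn_pred_eq; rewrite logn2_dvd // lB' ltnn.
(* Even meeting height: middles join at odd heights, so those joined by now were joined one level
   below, where consecutive vertices would already have met. *)
have inact x : ((l.+2 == 0) || (3 %| x) && (l.+2 < 2 * block_colour x + 3)) =
    false -> ruler_key l.+1 x = inr (x %/ 3 %/ 2 ^ l.+1./2).
  by move=> Hx; rewrite /ruler_key; case: ifP => // Hx'; move: Hx Hx' ol; lia.
have -> : ruler_rel (block_colour w) (block_colour w') l.+2 = false.
  by rewrite /ruler_rel; move: ol; lia.
apply/negbTE/negP => cw; apply: Nl; rewrite !inact //; congr inr.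
wlog Ew' : w w' w1 w1' ww' Hw Hw' Eq cw / w' = w.+1.
  move=> H; have [/eqP|/eqP] := orP cw => E; first by apply: H.
  by symmetry; apply: H => //; [apply: nesym | rewrite /consecutive orbC].
have [w3|w3] := boolP (3 %| w'); last by congr (_ %/ _); lia.
have [B EB] := dvdnP w3; rewrite mulnC in EB.
have -> : w' %/ 3 = B by lia.
have -> : w %/ 3 = B.-1 by lia.
have B0 : 0 < B by lia.
apply: divn_pred_eq; rewrite logn2_dvd // -ltnNge.
move: Hw'; rewrite w3 /= EB block_colour_mid; move: ol; lia.
Qed.

(** These positions lie in blocks numbered 1 to [2 ^ m - 1], none divisible by [2 ^ m]. *)
Lemma block_colour_lt m w : 1 < w -> w <= 3 * 2 ^ m - 2 -> block_colour w < m.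
Proof.
move=> w1 wm; have B0 : 0 < (w + 1) %/ 3 by lia.
rewrite /block_colour ltnNge -logn2_dvd //; apply/negP => /dvdn_leq.
by have := expn_gt0 2 m; lia.
Qed.

Lemma path_in_TM m : 0 < m -> TM (2 * m + 1) m (path_graph (3 * 2 ^ m - 4)).
Proof.
case: m => // m _; set n := _ - 4.
have n0 : 3 * 2 ^ m.+1 = n + 4.
  by have := expn_gt0 2 m; rewrite /n expnS; lia.
have bc (u : 'I_n.+1) : block_colour (u + 2) < m.+1.
  by apply: block_colour_lt; have := ltn_ord u; lia.
(* The shift by 2 puts vertex 0 at the start of block 1. *)
apply: (@TM_of_keys m.+1 (2 * m.+1 + 1) (path_graph n) _ ord0
  (fun t u => ruler_key t (u + 2)) (fun u => Ordinal (bc u))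
  (fun i j l => ruler_rel i j l)).
- by move=> u v [] /addIn /ord_inj.
- by move=> t u v; apply: ruler_keyS.
(* Colours are at most [m], so the last middle joins at height [2 * m + 3], the height of the root;
   all gap numbers are below [2 ^ m.+1], so a single group remains. *)
- suff top (u : 'I_n.+1) : ruler_key (2 * m.+1 + 1) (u + 2) = inr 0.
    by move=> u v; rewrite !top.
  rewrite /ruler_key; case: ifP; first by have := bc u; lia.
  move=> _; have -> : (2 * m.+1 + 1)./2 = m.+1 by lia.
  by rewrite divn_small //; have := ltn_ord u; lia.
- by move=> i j l; apply: ruler_rel_sym.
move=> u v l _ Nl El; rewrite /= -(ruler_key_adj _ _ Nl El); [|lia|lia].
by rewrite /path_adj /consecutive /=; lia.
Qed.

Theorem theorem3p7 (m : nat) (hm : 0 < m) :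
  TM (2 * m + 1) m (path_graph (3 * 2 ^ m - 4)) /\
  (forall d : nat, ~ TM d m (path_graph ((3 * 2 ^ m - 4) + 1))).
Proof.
split=> [|d]; first exact: path_in_TM.
apply: path_notin_TM; case: m hm => // m _.
by have := expn_gt0 2 m; rewrite expnS; lia.
Qed.
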